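(* Let $d>1$, let $\{f_n\}_{n\ge 1}$ be a $d$-decaying Gauss like iterated function system on $[0,1]$, and let $\{a_n(x)\}_{n\ge1}$ denote the digits of $x$ in this system. For $x\in(0,1)$ put $$\tau_1(x):=\inf\Big\{s\ge 0:\ \sum_{n\ge 1}a_n(x)^{-s}<\infty\Big\}\in[0,\infty].$$ Then for every $0\le\alpha<\infty$ the set $$E(\alpha):=\{x\in(0,1):\ \tau_1(x)=\alpha\}$$ satisfies $$\dim_{\rm H}E(\alpha)=\frac1d,$$ where $\dim_{\rm H}$ denotes Hausdorff dimension.
   Context: $\mathbb{N}=\{1,2,3,\dots\}$. Let $d>1$. A sequence $\{f_n\}_{n\ge1}$ of $C^1$ functions $f_n:[0,1]\to[0,1]$ is a $d$-decaying Gauss like iterated function system if: (i) (open set condition) $f_i((0,1))\cap f_j((0,1))=\emptyset$ for all $i\ne j$ in $\mathbb{N}$; (ii) (contraction) there exist $m\in\mathbb{N}$ and $0<\rho<1$ such that $0<|(f_{a_1}\circ\cdots\circ f_{a_m})'(x)|\le\rho<1$ for all $(a_1,\dots,a_m)\in\mathbb{N}^m$ and $x\in[0,1]$; (iii) (regularity) for every $\varepsilon>0$ there are constants $C_1=C_1(\varepsilon)>0$, $C_2=C_2(\varepsilon)>0$ such that for each $i\in\mathbb{N}$ there are constants $\xi_i,\lambda_i$ with $\xi_i\le|f_i'(x)|\le\lambda_i$ for all $x\in[0,1]$ and $\frac{C_1}{i^{d+\varepsilon}}\le\xi_i\le\lambda_i\le\frac{C_2}{i^{d-\varepsilon}}$;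 (iv) $\bigcup_{i=1}^\infty f_i([0,1])=(0,1]$, and $f_i(x)<f_j(x)$ whenever $i>j$; (v) (bounded distortion) there is $\kappa\ge1$ such that for every $n\in\mathbb{N}$ and $(a_1,\dots,a_n)\in\mathbb{N}^n$, $|(f_{a_1}\circ\cdots\circ f_{a_n})'(x)|\le\kappa\,|(f_{a_1}\circ\cdots\circ f_{a_n})'(y)|$ for all $x,y\in[0,1]$. Digits: for $\underline a=\{a_n\}_{n\ge1}\in\mathbb{N}^{\mathbb{N}}$ put $\Pi(\underline a)=\lim_{n\to\infty}f_{a_1}\circ\cdots\circ f_{a_n}(1)$. For all but countably many $x\in(0,1)$ there is exactly one $\underline a\in\mathbb{N}^{\mathbb{N}}$ with $\Pi(\underline a)=x$; its entries are the digits of $x$, written $a_n(x)$. Sets defined by digits are understood to consist of such points $x$ only (countable sets do not affect Hausdorff dimension). Convention: $\inf\emptyset=\infty$. *)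

(* Defs.v *)
From mathcomp Require Import all_boot all_order all_algebra.
From mathcomp Require Import all_classical all_reals all_analysis.

Set Implicit Arguments.
Unset Strict Implicit.
Unset Printing Implicit Defensive.

Import Order.TTheory GRing.Theory Num.Theory.
Import numFieldNormedType.Exports.

Local Open Scope classical_set_scope.
Local Open Scope ring_scope.

(** * Hausdorff dimension on the real line *)

Section hausdorff_dimension.
Context {R : realType}.
Implicit Types (s delta : R) (U E : set R).

Definition diam U : \bar R :=
  ereal_sup [set `|x.1 - x.2|%:E | x in U `*` U].

(* The empty set has gauge 0 for every s, including s = 0 (note that
   [diam set0 = -oo]); a singleton has gauge [0 `^ 0 = 1] when s = 0, so that
   the 0-dimensional Hausdorff measure is the counting measure. *)
Definition hausdorff_gauge s U : \bar R :=
  if pselect (U = set0) then 0%E else (diam U `^ s)%E.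

Definition delta_cover delta E (U : nat -> set R) : Prop :=
  E `<=` \bigcup_n U n /\ forall n, (diam (U n) <= delta%:E)%E.

Definition hausdorff_premeasure s delta E : \bar R :=
  ereal_inf [set (\sum_(0 <= n <oo) hausdorff_gauge s (U n))%E | U in delta_cover delta E].

Definition hausdorff_measure s E : \bar R :=
  ereal_sup [set hausdorff_premeasure s delta E | delta in [set delta | 0 < delta]].

Definition hausdorff_dim E : \bar R :=
  ereal_inf [set s%:E | s in [set s | 0 <= s /\ hausdorff_measure s E = 0%E]].

End hausdorff_dimension.

(** * C^1 functions on the closed unit interval *)

Section unit_interval_calculus.
Context {R : realType}.
Implicit Types (g : R -> R) (x : R).

(* Functions on [0, 1] are represented by functions on R whose values outside
   [0, 1] are irrelevant, hence the derivative below only uses points of [0, 1]: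
   it is one-sided at 0 and at 1. *)
Definition diff_quot g x : R -> R := fun y => (g y - g x) / (y - x).

Definition derivable01 g x : Prop :=
  cvg (diff_quot g x y @[y --> within `[0, 1] x^']).

Definition derive01 g x : R :=
  lim (diff_quot g x y @[y --> within `[0, 1] x^']).

Definition C1_01 g : Prop :=
  (forall x : R, x \in `[0, 1] -> derivable01 g x) /\
  {within `[0, 1], continuous (derive01 g)}.

End unit_interval_calculus.

(** * Gauss like iterated function systems *)

(* The index set is {1, 2, 3, ...}: [f 0] is never used, and words and digit
   sequences have positive entries. *)

Section gauss_like.
Context {R : realType}.
Implicit Types (d : R) (f : nat -> R -> R).

Definition comp_word f (w : seq nat) : R -> R :=
  foldr (fun i g => f i \o g) id w.

Record d_decaying_gauss_like d f : Prop := {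
  gl_range : forall i, (0 < i)%N -> f i @` `[0, 1] `<=` `[0, 1] ;
  gl_C1 : forall i, (0 < i)%N -> C1_01 (f i) ;
  gl_open_set : forall i j, (0 < i)%N -> (0 < j)%N -> i <> j ->
    (f i @` `]0, 1[) `&` (f j @` `]0, 1[) = set0 ;
  gl_contraction : exists (m : nat) (rho : R),
    [/\ (0 < m)%N, 0 < rho, rho < 1 &
      forall w : seq nat, size w = m -> all (leq 1) w ->
      forall x : R, x \in `[0, 1] ->
        0 < `|derive01 (comp_word f w) x| <= rho] ;
  gl_regularity : forall eps : R, 0 < eps ->
    exists C1 C2 : R, [/\ 0 < C1, 0 < C2 &
      forall i, (0 < i)%N -> exists xi lambda : R,
        (forall x : R, x \in `[0, 1] -> xi <= `|derive01 (f i) x| <= lambda) /\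
        [/\ C1 / i%:R `^ (d + eps) <= xi,
            xi <= lambda &
            lambda <= C2 / i%:R `^ (d - eps)]] ;
  gl_cover : \bigcup_(i in [set i | (0 < i)%N]) (f i @` `[0, 1]) = `]0, 1]%classic ;
  gl_order : forall i j, (0 < i)%N -> (0 < j)%N -> (j < i)%N ->
    forall x : R, x \in `[0, 1] -> f i x < f j x ;
  gl_distortion : exists kappa : R, 1 <= kappa /\
    forall w : seq nat, (0 < size w)%N -> all (leq 1) w ->
    forall x y : R, x \in `[0, 1] -> y \in `[0, 1] ->
      `|derive01 (comp_word f w) x| <= kappa * `|derive01 (comp_word f w) y|
}.

(* [a n] stands for the (n+1)-st entry of the sequence. *)
Definition coding f (x : R) (a : nat -> nat) : Prop :=
  (forall n, (0 < a n)%N) /\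
  comp_word f (mkseq a n) 1 @[n --> \oo] --> x.

Definition has_digits f (x : R) : Prop := exists! a, coding f x a.

(* Meaningful when [has_digits f x]. *)
Definition digits f (x : R) : nat -> nat := xget (fun=> 1%N) (coding f x).

Definition tau1 f (x : R) : \bar R :=
  ereal_inf [set s%:E | s in [set s : R | 0 <= s /\
    (\sum_(0 <= n <oo) (((digits f x n)%:R : R) `^ (- s))%:E < +oo)%E]].

Definition tau1_level_set f (alpha : R) : set R :=
  [set x | [/\ x \in `]0, 1[, has_digits f x & tau1 f x = alpha%:E]].

End gauss_like.

(* Main.v *)
Require Import Defs.
From mathcomp Require Import all_boot all_order all_algebra.
From mathcomp Require Import all_classical all_reals all_analysis.
From mathcomp Require Import lra ring zify.

(** Upper bound: a convergent sum forces the digits to tend to infinity.  The set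
   of points all of whose digits exceed [M] is covered by its own images under
   the [f i], [i > M], whose Lipschitz constants have [s]-th powers of total sum
   at most [1 / 2] when [s > 1 / d] and [M] is large; so it is covered with
   arbitrarily small [s]-content.

   Lower bound: pick a scale [k n] tending to infinity, with [k n.+1 = O(k n)],
   for which every digit sequence comparable to [k] has convergence exponent
   [alpha] ([2 ^ n] if [alpha = 0], [n ^ (1 / alpha)] otherwise).  Expand
   [t] in [0, 1) in the mixed radix [k] and let [g t] be the point whose digits
   are [2 (k n + b_n)], [b_n] being the radix digits of [t].  For [s < 1 / d]
   the inverse of [g] is [s]-Hölder, so a cover of the range of [g] with small
   [s]-content would give a cover of [0, 1) of Lebesgue measure less than 1. *)

Set Implicit Arguments.
Unset Strict Implicit.
Unset Printing Implicit Defensive.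

Import Order.TTheory GRing.Theory Num.Theory.
Import numFieldNormedType.Exports.

Local Open Scope classical_set_scope.
Local Open Scope ring_scope.

(** * Derivatives relative to [0, 1] and the mean value theorem *)

Section one_sided_derivative.
Context {R : realType}.
Implicit Types (g : R -> R) (x y : R).

(** A small ball around an interior point lies in [0, 1], so restricting the difference quotient to
    [0, 1] changes nothing there. This is what makes [MVT] applicable. *)
Lemma derive01_interior g x : 0 < x < 1 -> derivable01 g x ->
  is_derive x 1 g (derive01 g x).
Proof.
move=> /andP[x0 x1] gx.
have {}gx : diff_quot g x y @[y --> within `[0, 1] x^'] --> derive01 g x := gx.
have h : (h^-1 *: (g (h *: 1 + x) - g x)) @[h --> 0^'] --> derive01 g x.
  apply/cvgrPdist_lt => e e0.
  move/cvgrPdist_lt : gx => /(_ e e0).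
  rewrite /prop_near1/within/= /nbhs/=/dnbhs/within/= => /nbhs_ballP[r /= r0 hr].
  apply/nbhs_ballP; exists (Num.min r (Num.min x (1 - x))) => /=.
    by rewrite !lt_min r0 x0 subr_gt0.
  move=> h; rewrite /ball/= sub0r normrN !lt_min ltr_norml => /and3P[/andP[h1 h2]].
  rewrite !ltr_norml => /andP[h3 h4] /andP[h5 h6] h0.
  have := hr (h + x).
  rewrite /diff_quot /ball/= opprD addrCA subrr addr0 normrN ltr_norml h1 h2 => /(_ erefl).
  rewrite -subr_eq0 addrK h0 => /(_ erefl).
  rewrite in_itv/= => H; rewrite /GRing.scale/= mulr1 mulrC -ltr_norml.
  by apply: H; apply/andP; split; lra.
by split; [apply/cvg_ex; exists (derive01 g x)|exact/cvg_lim].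
Qed.

Lemma derivable01_continuous g :
  (forall x, x \in `[0, 1] -> derivable01 g x) ->
  {within `[0, 1], continuous g}.
Proof.
move=> dg; apply/subspace_continuousP => x /= x01.
have gx : diff_quot g x y @[y --> within `[0, 1] x^'] --> derive01 g x := dg _ x01.
apply/cvgrPdist_lt => e e0.
move/cvgrPdist_lt : gx => /(_ 1 ltr01).
rewrite /prop_near1/within/= /nbhs/=/dnbhs/within/= => /nbhs_ballP[r /= r0 hr].
set L := `|derive01 g x| + 1.
have L0 : 0 < L by rewrite ltr_pwDr.
apply/nbhs_ballP; exists (Num.min r (e / L)) => /=.
  by rewrite lt_min r0 divr_gt0.
move=> y; rewrite /ball/= lt_min => /andP[xyr xye] y01.
have [->|yx] := eqVneq y x; first by rewrite subrr normr0.
have := hr y xyr yx y01; rewrite /diff_quot => h.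
have qL : `|(g y - g x) / (y - x)| < L.
  rewrite -[X in `|X|](subKr (derive01 g x)) (le_lt_trans (ler_normB _ _))//.
  by rewrite ltrD2l.
have yx0 : 0 < `|y - x| by rewrite normr_gt0 subr_eq0.
move: qL; rewrite normrM normfV ltr_pdivrMr// => qL.
rewrite distrC (lt_trans qL)// -ltr_pdivlMl// mulrC distrC//.
Qed.

Lemma mean_value01 g x y : (forall z, z \in `[0, 1] -> derivable01 g z) ->
  x \in `[0, 1] -> y \in `[0, 1] ->
  exists2 c, c \in `[0, 1] & g x - g y = derive01 g c * (x - y).
Proof.
move=> dg.
wlog xy : x y / y < x => [hwlog|].
  move=> x01 y01; have [yx|xy|->] := ltgtP y x; first exact: hwlog.
    have [c c01 h] := hwlog _ _ xy y01 x01.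
    by exists c => //; rewrite -opprB h -mulrN opprB.
  by exists y => //; rewrite !subrr mulr0.
rewrite !in_itv/= => /andP[x0 x1] /andP[y0 y1].
have sub z : z \in `]y, x[ -> 0 < z < 1.
  by rewrite in_itv/= => /andP[h1 h2]; apply/andP; split; lra.
have [| |c cyx h] := @MVT R g (derive01 g) y x xy.
- move=> z /sub z01; apply: derive01_interior => //; apply: dg.
  by rewrite in_itv/=; case/andP : z01 => /ltW -> /ltW ->.
- apply: continuous_subspaceW (derivable01_continuous dg) => z /=.
  by rewrite !in_itv/= => /andP[h1 h2]; apply/andP; split; lra.
- exists c => //; case/sub/andP: cyx => h1 h2.
  by rewrite in_itv/= !ltW.
Qed.

End one_sided_derivative.

(** * Gauss like systems *)

Section gauss_like_systems.
Context {R : realType} (d : R) (f : nat -> R -> R).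
Hypothesis f_gauss : d_decaying_gauss_like d f.
Implicit Types (i j n : nat) (x y u v : R) (a b : nat -> nat).

(** The mean value theorem turns the regularity bounds on the derivative of [f i] into bounds on its
    increments, the form in which they enter all later metric estimates. *)
Lemma gauss_bilipschitz (eps : R) : 0 < eps ->
  exists C1 C2 : R, [/\ 0 < C1, 0 < C2 &
    forall i x y, (0 < i)%N -> x \in `[0, 1] -> y \in `[0, 1] ->
      C1 / i%:R `^ (d + eps) * `|x - y| <= `|f i x - f i y| <=
      C2 / i%:R `^ (d - eps) * `|x - y|].
Proof.
move=> /(gl_regularity f_gauss)[C1 [C2 [C10 C20 h]]].
exists C1, C2; split=> // i x y i0 x01 y01.
have [xi [la [dfi [C1xi _ laC2]]]] := h i i0.
have [c c01 ->] := mean_value01 (gl_C1 f_gauss i0).1 x01 y01.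
have /andP[h1 h2] := dfi c c01.
rewrite normrM; apply/andP; split; apply: ler_wpM2r => //.
- exact: le_trans h1.
- exact: le_trans laC2.
Qed.

Lemma gauss_continuous i : (0 < i)%N -> {within `[0, 1], continuous (f i)}.
Proof. by move=> i0; apply: derivable01_continuous (gl_C1 f_gauss i0).1. Qed.

Lemma gauss_mem i x : (0 < i)%N -> x \in `[0, 1] -> 0 < f i x <= 1.
Proof.
move=> i0 x01; have : `]0, 1]%classic (f i x).
  by rewrite -(gl_cover f_gauss); exists i => //; exists x.
by rewrite /= in_itv.
Qed.

Lemma gauss_mem01 i x : (0 < i)%N -> x \in `[0, 1] -> f i x \in `[0, 1].
Proof. by move=> i0 /(gauss_mem i0)/andP[x0 x1]; rewrite in_itv/= (ltW x0). Qed.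

Lemma gauss_inj i : (0 < i)%N -> {in `[0, 1] &, injective (f i)}.
Proof.
move=> i0 x y x01 y01 fxy.
have [C1 [C2 [C10 _ h]]] := gauss_bilipschitz ltr01.
have /andP[] := h i x y i0 x01 y01; rewrite fxy subrr normr0 => + _.
rewrite pmulr_rle0 ?normr_le0 ?subr_eq0; first by move/eqP.
by rewrite divr_gt0// powR_gt0 ?ltr0n.
Qed.

Let in01_0 : (0 : R) \in `[0, 1]. Proof. by rewrite in_itv/= lexx ler01. Qed.
Let in01_1 : (1 : R) \in `[0, 1]. Proof. by rewrite in_itv/= lexx ler01. Qed.

Let mem01_oo x : 0 < x < 1 -> x \in `[0, 1].
Proof. by move=> /andP[/ltW x0 /ltW x1]; rewrite in_itv/= x0. Qed.

(** The order condition gives [f i y < f j y]. If [f i x] exceeded [f j y], the intermediate value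
    theorem would give a [z] between [x] and [y], different from both and hence interior, with
    [f i z = f j y]; this contradicts the open set condition. *)
Lemma gauss_le_oc i j x y : (0 < j < i)%N -> x \in `[0, 1] -> 0 < y < 1 ->
  f i x <= f j y.
Proof.
move=> /andP[j0 ji] x01 y01; rewrite leNgt; apply/negP => fyx.
have i0 : (0 < i)%N by exact: leq_trans ji.
have y01' := mem01_oo y01.
have fijy := gl_order f_gauss i0 j0 ji y01'.
have sub z : z \in `[Num.min x y, Num.max x y] -> z \in `[0, 1].
  move: x01 y01'; rewrite !in_itv/= => /andP[x0 x1] /andP[y0 y1] /andP[h1 h2].
  rewrite (le_trans _ h1) ?(le_trans h2)//; first by rewrite ge_max x1 y1.
  by rewrite le_min x0 y0.
have cf : {within `[Num.min x y, Num.max x y], continuous (f i)}.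
  exact: continuous_subspaceW sub (gauss_continuous i0).
have [||z zxy fz] := @IVT R (f i) _ _ (f j y) _ cf.
- by rewrite ge_min !le_max lexx.
- have [xy|yx] := leP x y.
    by rewrite (min_r (ltW (lt_trans fijy fyx))) (max_l (ltW (lt_trans fijy fyx))) !ltW.
  by rewrite (min_l (ltW (lt_trans fijy fyx))) (max_r (ltW (lt_trans fijy fyx))) !ltW.
have z01 : 0 < z < 1.
  have := sub _ zxy; rewrite in_itv/= => /andP[z0 z1].
  have zx : z != x by apply: contraTneq fyx => <-; rewrite fz ltxx.
  have zy : z != y by apply: contraTneq fijy => zy; rewrite -{1}zy fz ltxx.
  move: zxy; rewrite in_itv/= => /andP[h1 h2].
  have {}h1 : Num.min x y < z.
    by rewrite lt_neqAle h1 andbT minEle; case: ifP; rewrite eq_sym.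
  have {}h2 : z < Num.max x y.
    by rewrite lt_neqAle h2 andbT maxEle; case: ifP.
  move: x01 y01; rewrite in_itv/= => /andP[x0 x1] /andP[y0 y1].
  rewrite (le_lt_trans _ h1) ?(lt_le_trans h2)// ?ge_max ?le_min ?x0 ?x1 /= ltW//.
have : (f i @` `]0, 1[ `&` f j @` `]0, 1[) (f j y).
  by split; [exists z | exists y] => //=; rewrite in_itv.
rewrite (gl_open_set f_gauss) // => ij.
by move: ji; rewrite ij ltnn.
Qed.

(* The case of an endpoint [y] follows by moving [y] slightly towards [1 / 2]. *)
Lemma gauss_le i j x y : (0 < j < i)%N -> x \in `[0, 1] -> y \in `[0, 1] ->
  f i x <= f j y.
Proof.
move=> ji x01 y01; have /andP[j0 _] := ji.
have [C1 [C2 [_ C20 h]]] := gauss_bilipschitz ltr01.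
set L := C2 / j%:R `^ (d - 1).
have L0 : 0 < L by rewrite divr_gt0// powR_gt0 ?ltr0n.
apply/ler_addgt0Pr => e e0.
pose t := Num.min 1 (e / L).
have t0 : 0 < t by rewrite lt_min ltr01 divr_gt0.
have t1 : t <= 1 by rewrite ge_min lexx.
have te : t <= e / L by rewrite ge_min lexx orbT.
pose y' := y + t * (2^-1 - y).
have y'01 : 0 < y' < 1.
  move: y01; rewrite in_itv/= => /andP[y0 y1].
  rewrite /y'; clearbody t; apply/andP; split; nra.
apply: le_trans (gauss_le_oc ji x01 y'01) _.
have /andP[_] := h j y' y j0 (mem01_oo y'01) y01.
rewrite ler_norml => /andP[_]; rewrite -/L lerBlDl => /le_trans; apply.
rewrite lerD2l /y' (addrC y) addrK normrM (gtr0_norm t0).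
have n1 : `|2^-1 - y| <= 1.
  by move: y01; rewrite in_itv/= ler_norml => /andP[y0 y1]; lra.
apply: (@le_trans _ _ (L * t)).
  by rewrite ler_pM2l// ler_piMr// ltW.
by rewrite mulrC -ler_pdivlMr.
Qed.

(** A continuous injective map on [0, 1] is strictly monotone, so its value at an interior point is
    not extremal. Were [f i x] and [f j y] equal, an endpoint value of the map taken at its interior
    point would violate [gauss_le]. *)
Lemma gauss_lt i j x y : (0 < j < i)%N -> x \in `[0, 1] -> y \in `[0, 1] ->
  0 < x < 1 \/ 0 < y < 1 -> f i x < f j y.
Proof.
move=> ji x01 y01 xy.
have /andP[j0 jltni] := ji; have i0 : (0 < i)%N := ltn_trans j0 jltni.
rewrite lt_neqAle gauss_le// andbT; apply/eqP => fxy.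
have key k z : (0 < k)%N -> 0 < z < 1 ->
    exists2 l, l \in `[0, 1] & exists2 r, r \in `[0, 1] & f k l < f k z < f k r.
  move=> k0 /andP[z0 z1].
  have z01 : z \in `[0, 1] by rewrite mem01_oo ?z0.
  by have [fm|fm] := itv_continuous_inj_mono (gauss_continuous k0) (gauss_inj k0);
    [exists 0 => //; exists 1 => //|exists 1 => //; exists 0 => //];
    apply/andP; split; apply: fm.
case: xy => [x01'|y01'].
  have [_ _ [r r01 /andP[_]]] := key i x i0 x01'.
  by rewrite fxy ltNge gauss_le.
have [l l01 [_ _ /andP[+ _]]] := key j y j0 y01'.
by rewrite -fxy ltNge gauss_le.
Qed.

(** The whole image of [f l] lies between those of [f i] and [f j]. *)
Lemma gauss_gap i j l x y : (0 < j < l)%N -> (l < i)%N ->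
  x \in `[0, 1] -> y \in `[0, 1] -> `|f l 1 - f l 0| <= `|f i x - f j y|.
Proof.
move=> /andP[j0 jl] li x01 y01.
have l0 : (0 < l)%N := leq_trans j0 (ltnW jl).
have h1 z : z \in `[0, 1] -> f i x <= f l z by move=> z01; apply: gauss_le => //; rewrite l0.
have h2 z : z \in `[0, 1] -> f l z <= f j y by move=> z01; apply: gauss_le => //; rewrite j0.
rewrite [leRHS]distrC [leRHS]ger0_norm ?subr_ge0 ?(le_trans (h1 _ in01_0)) ?h2//.
have := (h1 _ in01_0, h1 _ in01_1, h2 _ in01_0, h2 _ in01_1).
by rewrite ler_norml => -[[[? ?] ?] ?]; apply/andP; split; lra.
Qed.

Lemma comp_word_mem01 (w : seq nat) x : all (leq 1) w -> x \in `[0, 1] ->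
  comp_word f w x \in `[0, 1].
Proof. by elim: w => //= i w IH /andP[i0 /IH{}IH] x01; exact/gauss_mem01/IH. Qed.

Lemma mkseq_pos a n : (forall m, (0 < a m)%N) -> all (leq 1) (mkseq a n).
Proof. by move=> a0; apply/allP => _ /mapP[m _ ->]. Qed.

Lemma comp_word_mkseqS a n x :
  comp_word f (mkseq a n.+1) x = f (a 0%N) (comp_word f (mkseq (a \o S) n) x).
Proof. by rewrite /mkseq/= -[1%N]add1n iotaDl -map_comp. Qed.

Lemma coding_mem01 x a : coding f x a -> x \in `[0, 1].
Proof.
move=> [a0 ax].
have cl : closed `[0 : R, 1]%classic by exact: interval_closed.
apply: (closed_cvg _ cl _ _ ax) => //; apply: nearW => n.
exact: comp_word_mem01 (mkseq_pos _ a0) in01_1.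
Qed.

(** The approximants of [x] lie in the compact image of [f (a 0)], so [x] does too; the lower
    Lipschitz bound then carries the convergence back to the preimage [u]. This allows inductions
    that remove the first digit. *)
Lemma coding_step x a : coding f x a ->
  exists u, [/\ u \in `[0, 1], x = f (a 0%N) u & coding f u (a \o S)].
Proof.
move=> [a0 ax].
pose y n := comp_word f (mkseq (a \o S) n) 1.
have y01 n : y n \in `[0, 1].
  exact: comp_word_mem01 (mkseq_pos _ (fun m => a0 m.+1)) in01_1.
have fyx : f (a 0%N) (y n) @[n --> \oo] --> x.
  move: ax; rewrite -cvg_shiftS /=; apply: cvg_trans; apply: near_eq_cvg.
  by apply: nearW => n; rewrite -comp_word_mkseqS.
have cl : closed (f (a 0%N) @` `[0 : R, 1]).
  apply: compact_closed => //.
  by apply: continuous_compact (@segment_compact _ 0 1); exact: gauss_continuous.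
have [u u01 fu] : (f (a 0%N) @` `[0 : R, 1]) x.
  by apply: (closed_cvg _ cl _ _ fyx) => //; apply: nearW => n; exists (y n) => //=.
exists u; split=> //; split=> [n /=|]; first exact: a0.
have [C1 [C2 [C10 _ h]]] := gauss_bilipschitz ltr01.
set L := C1 / (a 0%N)%:R `^ (d + 1).
have L0 : 0 < L by rewrite divr_gt0// powR_gt0 ?ltr0n.
apply/cvgrPdist_lt => e e0.
move/cvgrPdist_lt : fyx => /(_ (L * e) (mulr_gt0 L0 e0)); apply: filterS => n.
rewrite -fu; have /andP[+ _] := h (a 0%N) u (y n) (a0 _) u01 (y01 n).
by move=> /le_lt_trans h1 /h1; rewrite ltr_pM2l.
Qed.

Lemma gauss_coding_pos x a : coding f x a -> 0 < x.
Proof.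
move=> xa; have [a0 _] := xa; have [u [u01 -> _]] := coding_step xa.
by have /andP[] := gauss_mem (a0 0%N) u01.
Qed.

Lemma gauss_coding_lt1 x a : coding f x a -> (1 < a 0)%N -> x < 1.
Proof.
move=> xa a1; have [a0 _] := xa; have [u [u01 -> _]] := coding_step xa.
apply: lt_le_trans (gl_order f_gauss (a0 0%N) _ a1 u01) _ => //.
by have /andP[] := gauss_mem (ltn0Sn 0) u01.
Qed.

(** Digits above 1 keep the point coded by the shift of [a] away from the endpoints, and [gauss_lt]
    needs only one interior argument; so [b] may be any code. *)
Lemma coding_head_unique x a b : (forall n, 1 < a n)%N ->
  coding f x a -> coding f x b -> a 0%N = b 0%N.
Proof.
move=> a1 xa xb; have [a0 _] := xa; have [b0 _] := xb.
have [u [u01 xu ua]] := coding_step xa; have [v [v01 xv vb]] := coding_step xb.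
have u01' : 0 < u < 1 by rewrite (gauss_coding_pos ua) (gauss_coding_lt1 ua) //=.
have [lab|lba|->//] := ltngtP (a 0%N) (b 0%N).
- have : f (b 0%N) v < f (a 0%N) u by apply: gauss_lt; rewrite ?a0//; right.
  by rewrite -xu -xv ltxx.
- have : f (a 0%N) u < f (b 0%N) v by apply: gauss_lt; rewrite ?b0//; left.
  by rewrite -xu -xv ltxx.
Qed.

Lemma coding_unique x a b : (forall n, 1 < a n)%N ->
  coding f x a -> coding f x b -> a = b.
Proof.
move=> a1 xa xb; apply/funext => n.
elim: n x a b a1 xa xb => [|n IH] x a b a1 xa xb.
  exact: coding_head_unique xa xb.
have ab := coding_head_unique a1 xa xb.
have [u [u01 xu ua]] := coding_step xa; have [v [v01 xv vb]] := coding_step xb.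
have uv : u = v.
  by apply: (@gauss_inj (a 0%N)); rewrite -?xu ?ab -?xv//; exact: xb.1.
by rewrite -uv in vb; have := IH u _ _ (fun m => a1 m.+1) ua vb.
Qed.

End gauss_like_systems.

Lemma half_expr_lt (R : realType) (e : R) : 0 < e -> exists n : nat, 2^-1 ^+ n < e.
Proof.
move=> e0; have h : (2^-1 : R) ^+ n @[n --> \oo] --> 0.
  by apply: cvg_expr; rewrite ger0_norm// invf_lt1// ltr1n.
move/cvgrPdist_lt : h => /(_ e e0)[n _ hn].
by exists n; have := hn n (leqnn n); rewrite sub0r normrN ger0_norm.
Qed.

(** * Existence and separation of coded points *)

Section codings.
Context {R : realType} (d : R) (f : nat -> R -> R).
Hypothesis d_gt1 : 1 < d.
Hypothesis f_gauss : d_decaying_gauss_like d f.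
Implicit Types (i j n : nat) (x y u v : R) (a b : nat -> nat).

(** Regularity with [eps = d - 1] gives the Lipschitz constant [C2 / i], which is at most 1/2 once
    [i >= 2 * C2]. *)
Lemma gauss_eventually_half : exists2 M : nat, (0 < M)%N &
  forall i x y, (M <= i)%N -> x \in `[0, 1] -> y \in `[0, 1] ->
    `|f i x - f i y| <= 2^-1 * `|x - y|.
Proof.
have d1 : 0 < d - 1 by rewrite subr_gt0.
have [C1 [C2 [_ C20 h]]] := gauss_bilipschitz f_gauss d1.
exists (Num.truncn (C2 * 2)).+1 => // i x y Mi x01 y01.
have i0 : (0 < i)%N by exact: leq_trans Mi.
have /andP[_ /le_trans] := h i x y i0 x01 y01; apply.
apply: ler_wpM2r => //; rewrite subKr powRr1 ?ler0n// ler_pdivrMr ?ltr0n//.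
rewrite ler_pdivlMl// mulrC.
by rewrite (le_trans (ltW (truncnS_gt _)))// ler_nat.
Qed.

(** With digits at least [M] every map halves distances, so lengthening a word of length [n] moves
    its value at 1 by at most [2^-n], and the approximants form a Cauchy sequence. *)
Lemma coding_exists : exists M : nat, forall a,
  (forall n, M <= a n)%N -> exists x, coding f x a.
Proof.
have [M M0 half] := gauss_eventually_half.
exists M => a aM.
have in01_1 : (1 : R) \in `[0, 1] by rewrite in_itv/= lexx ler01.
pose y a n : R := comp_word f (mkseq a n) 1.
have y01 b n : (forall m, M <= b m)%N -> y b n \in `[0, 1].
  move=> bM; apply: (comp_word_mem01 f_gauss _ in01_1); apply: mkseq_pos => m.
  exact: leq_trans (bM m).
have yC n b m : (forall m, M <= b m)%N -> `|y b (n + m)%N - y b n| <= 2^-1 ^+ n.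
  elim: n b => [|n IH] b bM.
    have := y01 b m bM; rewrite in_itv/= => /andP[? ?].
    by rewrite add0n (_ : y b 0%N = 1)// expr0 ler_norml; apply/andP; split; lra.
  rewrite /y addSn !comp_word_mkseqS exprS.
  apply: le_trans (half _ _ _ (bM _) _ _) _.
  - by apply: y01 => k; exact: bM.
  - by apply: y01 => k; exact: bM.
  - by rewrite ler_pM2l// IH// => k; exact: bM.
suff /cvg_ex[x yx] : cvgn (y a).
  by exists x; split=> // n; exact: leq_trans (aM n).
apply/cauchy_cvgP/cauchy_exP => e e0.
have [N Ne] := half_expr_lt e0.
exists (y a N); exists N => // n /= Nn; rewrite /ball/= distrC.
by rewrite -(subnKC Nn) (le_lt_trans (yC _ _ _ aM)).
Qed.

(** Before position [n] both codes apply the same maps, each with a lower Lipschitz constant. At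
    position [n] the two even digits differ, so the image of an odd-indexed map separates the two
    points. *)
Lemma coding_separation (eps : R) : 0 < eps -> exists2 c : R, 0 < c &
  forall (k : nat -> nat) n a b x y,
    (forall m, 0 < k m)%N -> coding f x a -> coding f y b ->
    (forall m, a m <= 4 * k m)%N -> (forall m, b m <= 4 * k m)%N ->
    (forall m, ~~ odd (a m)) -> (forall m, ~~ odd (b m)) ->
    (forall m, (m < n)%N -> a m = b m) -> a n != b n ->
    \prod_(m < n.+1) (c / (k m)%:R `^ (d + eps)) <= `|x - y|.
Proof.
move=> e0; have [C1 [C2 [C10 _ h]]] := gauss_bilipschitz f_gauss e0.
have de0 : 0 <= d + eps by rewrite addr_ge0 ?(ltW e0)// (le_trans ler01)// ltW.
(* Dividing by this power of 4 absorbs the factor in the digit bound [4 * k m]. *)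
pose c := C1 / 4 `^ (d + eps).
have c0 : 0 < c by rewrite divr_gt0// powR_gt0.
exists c => //.
have lc l q : (0 < l)%N -> (0 < q)%N -> (l <= 4 * q)%N ->
    c / q%:R `^ (d + eps) <= C1 / l%:R `^ (d + eps).
  move=> l0 q0 lq; rewrite /c -mulrA -invfM -powRM ?ler0n//.
  rewrite ler_pM2l// lef_pV2 ?posrE ?powR_gt0 ?mulr_gt0 ?ltr0n//.
  by rewrite ge0_ler_powR ?nnegrE ?mulr_ge0 ?ler0n// -natrM ler_nat.
have in01_0 : (0 : R) \in `[0, 1] by rewrite in_itv/= lexx ler01.
have in01_1 : (1 : R) \in `[0, 1] by rewrite in_itv/= lexx ler01.
have even_gap p q : (p < q)%N -> ~~ odd p -> ~~ odd q -> (p.+1 < q)%N.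
  move=> pq op oq; rewrite ltn_neqAle pq andbT.
  by apply: contraNneq oq => <-; rewrite /= op.
have gap i j u v q : (0 < j < i)%N -> (i <= 4 * q)%N -> ~~ odd i -> ~~ odd j ->
    (0 < q)%N -> u \in `[0, 1] -> v \in `[0, 1] ->
    c / q%:R `^ (d + eps) <= `|f i u - f j v|.
  move=> /andP[j0 ji] iq oi oj q0 u01 v01.
  have jj := even_gap _ _ ji oj oi.
  apply: le_trans (gauss_gap f_gauss _ jj u01 v01); last by rewrite j0 ltnSn.
  have /andP[+ _] := h j.+1 1 0 (ltn0Sn _) in01_1 in01_0.
  rewrite subr0 normr1 mulr1; apply: le_trans; apply: lc => //.
  exact: leq_trans (ltnW jj) iq.
(* The scale [k] varies in the induction, since removing the first digit shifts it as well. *)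
move=> k n; elim: n k => [|n IH] k a b x y k0 xa yb ak bk oa ob ab abn.
all: have [u [u01 xu ua]] := coding_step f_gauss xa.
all: have [v [v01 yv vb]] := coding_step f_gauss yb.
all: have [a0 _] := xa; have [b0 _] := yb.
  rewrite big_ord_recl big_ord0 mulr1 /= xu yv.
  have [lab|lba|/eqP] := ltngtP (a 0%N) (b 0%N); last by rewrite (negbTE abn).
  - by rewrite distrC; apply: gap => //; rewrite a0.
  - by apply: gap => //; rewrite b0.
rewrite big_ord_recl /= xu yv -(ab 0%N)//.
have /andP[+ _] := h (a 0%N) u v (a0 _) u01 v01; apply: le_trans.
apply: ler_pM.
- by rewrite divr_ge0 ?powR_ge0// ltW.
- by apply: prodr_ge0 => m _; rewrite divr_ge0 ?powR_ge0// ltW.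
- exact: lc.
- exact: (IH (k \o S) _ _ u v (fun m => k0 m.+1) ua vb (fun m => ak m.+1)
    (fun m => bk m.+1) (fun m => oa m.+1) (fun m => ob m.+1)
    (fun m => ab m.+1) abn).
Qed.

End codings.

(** * Sets of zero Hausdorff content *)

Lemma poweR_le {R : realType} (s : R) (a b : \bar R) :
  0 <= s -> (0 <= a -> a <= b -> a `^ s <= b `^ s)%E.
Proof.
move=> s0 a0 ab; apply: gt0_ler_poweR => //; rewrite in_itv/= ?a0 ?leey//.
by rewrite (le_trans a0 ab).
Qed.

Section hausdorff_null.
Context {R : realType} (s : R).
Hypothesis s_gt0 : 0 < s.
Implicit Types (E U : set R) (c : R).

Lemma hausdorff_gauge_ge0 U : (0 <= hausdorff_gauge s U)%E.
Proof. by rewrite /hausdorff_gauge; case: pselect => //= _; exact: poweR_ge0. Qed.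

Lemma diam_ge0 U : U !=set0 -> (0 <= diam U)%E.
Proof.
move=> [x Ux]; apply: ereal_sup_ubound; exists (x, x) => //=.
by rewrite subrr normr0.
Qed.

Lemma le_diam U (x y : R) : U x -> U y -> (`|x - y|%:E <= diam U)%E.
Proof. by move=> Ux Uy; apply: ereal_sup_ubound; exists (x, y). Qed.

Lemma diam_le U c : (forall x y, U x -> U y -> `|x - y| <= c) -> (diam U <= c%:E)%E.
Proof. by move=> h; apply: ge_ereal_sup => _ [[x y] [Ux Uy] <-]; rewrite lee_fin h. Qed.

(** A bound on the [s]-dimensional Hausdorff content: the diameters of the covering sets are
    unrestricted, which makes it stable under Lipschitz images and iteration. *)
Definition coverable E c := exists U : nat -> set R,
  E `<=` \bigcup_n U n /\ (\sum_(0 <= n <oo) hausdorff_gauge s (U n) <= c%:E)%E.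

Lemma sub_coverable E E' c : E `<=` E' -> coverable E' c -> coverable E c.
Proof. by move=> EE' [U [E'U Uc]]; exists U; split => //; exact: subset_trans E'U. Qed.

Lemma le_coverable E c c' : c <= c' -> coverable E c -> coverable E c'.
Proof.
move=> cc' [U [EU Uc]]; exists U; split => //.
by rewrite (le_trans Uc)// lee_fin.
Qed.

Lemma coverable01 : coverable `[0, 1]%classic 1.
Proof.
exists (fun n => if n is 0%N then `[0, 1]%classic else set0); split.
  by move=> x x01; exists 0%N.
rewrite nneseries_recl//; last by move=> k _; exact: hausdorff_gauge_ge0.
rewrite eseries0 ?adde0; last first.
  by move=> [|k]// _ _; rewrite /hausdorff_gauge; case: pselect.
rewrite /hausdorff_gauge; case: pselect => //= _.
rewrite -(poweR1r s); apply: poweR_le; first exact: ltW.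
  by apply: diam_ge0; exists 0; rewrite /= in_itv/= lexx ler01.
apply: diam_le => x y /=; rewrite !in_itv/= => /andP[? ?] /andP[? ?].
by rewrite ler_norml; apply/andP; split; lra.
Qed.

Lemma coverable_bigcup (E : nat -> set R) (c : nat -> R) C :
  (forall i, coverable (E i) (c i)) ->
  (\sum_(0 <= i <oo) (c i)%:E <= C%:E)%E -> coverable (\bigcup_i E i) C.
Proof.
move=> /choice[U /all_and2[EU Uc]] cC.
(* A bijection of [nat] with [nat * nat] lists all the covers as one sequence; the terms are
   nonnegative, so the double sum may be rearranged. *)
have /card_esym/ppcard_eqP[h] := card_nat2.
exists (fun n => U (h n).1 (h n).2); split.
  move=> x [i _ /EU[j _ Ux]]; exists (h^-1%FUN (i, j)) => //.
  by rewrite invK ?inE.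
apply: le_trans cC.
rewrite nneseries_esumT; last by move=> n; exact: hausdorff_gauge_ge0.
rewrite -(@reindex_esum _ _ _ setT setT h
  (fun k => hausdorff_gauge s (U k.1 k.2))); last exact: bij.
apply: (@le_trans _ _ (\sum_(0 <= i <oo) \sum_(0 <= j <oo) hausdorff_gauge s (U i j)))%E.
  rewrite nneseries_esumT; last first.
    by move=> n; apply: nneseries_ge0 => *; exact: hausdorff_gauge_ge0.
  rewrite (eq_esum (b := fun i => \esum_(j in setT) hausdorff_gauge s (U i j))); last first.
    by move=> i _; rewrite nneseries_esumT// => j; exact: hausdorff_gauge_ge0.
  rewrite esum_esum; last by move=> *; exact: hausdorff_gauge_ge0.
  by rewrite (_ : _ `*`` _ = setT)//; apply/seteqP; split.
apply: lee_nneseries => [i _ _|i _]; last exact: Uc.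
by apply: nneseries_ge0 => *; exact: hausdorff_gauge_ge0.
Qed.

Lemma coverable_image (g : R -> R) E (L c : R) : 0 <= L -> E `<=` `[0, 1] ->
  (forall x y, x \in `[0, 1] -> y \in `[0, 1] -> `|g x - g y| <= L * `|x - y|) ->
  coverable E c -> coverable (g @` E) (L `^ s * c).
Proof.
move=> L0 E01 gL [U [EU Uc]].
(* The covering sets are cut down to [0, 1], where [g] is Lipschitz. Empty images are treated apart
   below, because [diam set0] is [-oo]. *)
exists (fun n => g @` (U n `&` `[0, 1])); split.
  move=> _ [x Ex <-]; have [n _ Ux] := EU _ Ex; exists n => //.
  by exists x => //; split=> //; exact: E01.
rewrite EFinM; apply: (@le_trans _ _
  (\sum_(0 <= n <oo) ((L `^ s)%:E * hausdorff_gauge s (U n))))%E.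
  apply: lee_nneseries => [i _ _|i _]; first exact: hausdorff_gauge_ge0.
  have [->|] := eqVneq (g @` (U i `&` `[0, 1])) set0.
    rewrite {1}/hausdorff_gauge; case: pselect => //= _.
    by rewrite mule_ge0 ?hausdorff_gauge_ge0// lee_fin powR_ge0.
  rewrite {1}/hausdorff_gauge; case: pselect => /= [->|_ /set0P gU]; first by rewrite eqxx.
  have Ui : U i !=set0 by case: gU => _ [x [Ux _] _]; exists x.
  rewrite /hausdorff_gauge; case: pselect => /= [U0|_]; first by case: Ui; rewrite U0.
  rewrite -poweR_EFin -poweRM ?lee_fin//; last exact: diam_ge0.
  apply: poweR_le; [exact: ltW|exact: diam_ge0|].
  apply: ge_ereal_sup => _ [[_ _] [[x [Ux x01] <-] [y [Uy y01] <-]] <-] /=.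
  apply: (@le_trans _ _ (L%:E * `|x - y|%:E))%E; first by rewrite -EFinM lee_fin gL.
  by apply: lee_pmul => //; exact: le_diam.
rewrite nneseriesZl; last by move=> *; exact: hausdorff_gauge_ge0.
apply: lee_pmul => //; rewrite ?lee_fin ?powR_ge0//.
by apply: nneseries_ge0 => *; exact: hausdorff_gauge_ge0.
Qed.

Definition content_null E := forall c, 0 < c -> coverable E c.

Lemma content_null_sub E E' : E `<=` E' -> content_null E' -> content_null E.
Proof. by move=> EE' E0 c c0; exact: sub_coverable EE' (E0 c c0). Qed.

Lemma content_null_bigcup (E : nat -> set R) :
  (forall i, content_null (E i)) -> content_null (\bigcup_i E i).
Proof.
move=> E0 c c0; apply: (coverable_bigcup (c := fun i => c / (2 ^ i.+1)%:R)).
  by move=> i; apply: E0; rewrite divr_gt0// ltr0n expn_gt0.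
have := @epsilon_trick R (fun=> 0%E) c xpredT (fun=> lexx _) (ltW c0).
rewrite [X in (_ <= X + _)%E]eseries0// add0e; apply: le_trans.
by apply: lee_nneseries => [i _ _|i _]; rewrite ?add0e// lee_fin divr_ge0 ?ler0n// ltW.
Qed.

Lemma content_null_image (g : R -> R) E (L : R) : 0 < L -> E `<=` `[0, 1] ->
  (forall x y, x \in `[0, 1] -> y \in `[0, 1] -> `|g x - g y| <= L * `|x - y|) ->
  content_null E -> content_null (g @` E).
Proof.
move=> L0 E01 gL E0 c c0.
rewrite -(mulVKf (lt0r_neq0 (powR_gt0 s L0)) c).
apply: coverable_image => //; first exact: ltW.
by apply: E0; rewrite mulr_gt0 ?invr_gt0 ?powR_gt0.
Qed.

(** Each term of a cover is bounded by the total, so a total of at most [delta^s] forces every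
    diameter to be at most [delta] (here [s > 0]). Covers of small content are thus admissible at
    any prescribed scale. *)
Lemma content_null_measure E : content_null E -> hausdorff_measure s E = 0%E.
Proof.
move=> E0.
have pm_ge0 delta : (0 <= hausdorff_premeasure s delta E)%E.
  apply: le_ereal_inf_tmp => _ [U _ <-].
  by apply: nneseries_ge0 => *; exact: hausdorff_gauge_ge0.
apply/eqP; rewrite eq_le; apply/andP; split; last first.
  apply: (le_trans (pm_ge0 1)); apply: ereal_sup_ubound.
  by exists 1 => //=; exact: ltr01.
apply: ge_ereal_sup => _ [delta /= delta0 <-].
apply/lee_addgt0Pr => e e0; rewrite add0e.
have [|U [EU Uc]] := E0 (Num.min e (delta `^ s)); first by rewrite lt_min e0 powR_gt0.
apply: (@le_trans _ _ (\sum_(0 <= n <oo) hausdorff_gauge s (U n))%E); last first.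
  by apply: (le_trans Uc); rewrite lee_fin ge_min lexx.
apply: ereal_inf_lbound; exists U => //; split=> // n.
have : (hausdorff_gauge s (U n) <= (delta `^ s)%:E)%E.
  apply: (@le_trans _ _ (\sum_(0 <= n <oo) hausdorff_gauge s (U n))%E); last first.
    by apply: (le_trans Uc); rewrite lee_fin ge_min lexx orbT.
  apply: le_trans (@nneseries_lim_ge _ _ xpredT 0%N n.+1 _); last first.
    by move=> *; exact: hausdorff_gauge_ge0.
  rewrite big_nat_recr//= leeDr//.
  by apply: sume_ge0 => *; exact: hausdorff_gauge_ge0.
rewrite /hausdorff_gauge; case: pselect => /= [->|U0].
  by move=> _; apply: diam_le.
have : (0 <= diam (U n))%E by apply: diam_ge0; apply/set0P/eqP.
case: (diam (U n)) => [r| |] //.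
- rewrite poweR_EFin !lee_fin => r0; apply: contraTT; rewrite -!ltNge => dr.
  by apply: gt0_ltr_powR => //; rewrite nnegrE ltW.
- by rewrite poweRyr ?gt_eqF// leye_eq.
Qed.

End hausdorff_null.

(** * The upper bound *)

Section power_series.
Context {R : realType}.
Implicit Types (p q x c : R).

(** Discrete integral comparison: it bounds the terms of the series by telescoping differences.
    After factoring out [(x + 1)^-q] it says that [(x / (x + 1))^-q >= 1 + q / (x + 1)], which
    follows from [exp y >= 1 + y] and [ln (1 + y) <= y]. *)
Lemma powRN_sub_ge q x : 0 < q -> 0 < x ->
  q * (x + 1) `^ (- (q + 1)) <= x `^ (- q) - (x + 1) `^ (- q).
Proof.
move=> q0 x0; have x10 : 0 < x + 1 by rewrite addr_gt0.
have -> : (x + 1) `^ (- (q + 1)) = (x + 1) `^ (- q) * (x + 1)^-1.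
  by rewrite opprD powRD ?powR_inv1 ?(ltW x10)// (gt_eqF x10) implybT.
have -> : x `^ (- q) = (x + 1) `^ (- q) * (x / (x + 1)) `^ (- q).
  rewrite -powRM ?divr_ge0 ?(ltW x10) ?(ltW x0)//.
  by rewrite mulrC divfK// gt_eqF.
rewrite mulrCA -[X in _ <= _ - X]mulr1 -mulrBr ler_pM2l ?powR_gt0// lerBrDl.
rewrite /powR ifF; last by rewrite mulf_eq0 invr_eq0 !gt_eqF.
apply: le_trans (expR_ge1Dx _); rewrite lerD2l mulNr -mulrN.
rewrite ler_pM2l// lerNr.
have -> : x / (x + 1) = 1 + - (x + 1)^-1.
  by field; exact: lt0r_neq0.
apply: le_ln1Dx; rewrite ltrN2 invf_lt1// ltrDr//.
Qed.

Lemma power_series_tail p c : 1 < p -> 0 < c -> exists M : nat,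
  (\sum_(0 <= i <oo) ((i + M).+1%:R `^ (- p) : R)%:E <= c%:E)%E.
Proof.
move=> p1 c0; pose q := p - 1; have q0 : 0 < q by rewrite subr_gt0.
have pq : p = q + 1 by rewrite subrK.
(* [B] solves [B^-q = q * c]; the telescoped tail beyond [M >= B] is at most [M^-q / q <= c]. *)
pose B := (q * c) `^ (- q^-1).
pose M := (Num.truncn B).+1; exists M.
have MB : B <= M%:R by rewrite ltW// truncnS_gt.
have Mc : M%:R `^ (- q) <= q * c.
  rewrite powRN -[leRHS]invrK lef_pV2 ?posrE ?powR_gt0 ?invr_gt0 ?mulr_gt0 ?ltr0n//.
  rewrite -(powR_inv1 (ltW (mulr_gt0 q0 c0))) -[X in _ `^ (- X)](mulVf (lt0r_neq0 q0)).
  rewrite -mulNr powRrM; apply: ge0_ler_powR; rewrite ?nnegrE ?powR_ge0 ?ler0n//.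
  exact: ltW.
have bound n : q * \sum_(0 <= i < n) (i + M).+1%:R `^ (- p) <=
    M%:R `^ (- q) - (n + M)%:R `^ (- q).
  elim: n => [|n IH]; first by rewrite big_nil mulr0 subrr.
  rewrite big_nat_recr//= mulrDr.
  have := @powRN_sub_ge q (n + M)%:R q0; rewrite ltr0n addn_gt0 orbT => /(_ isT).
  by rewrite natr1 -pq addSn; lra.
apply: lime_le; first by apply: is_cvg_nneseries => *; rewrite lee_fin powR_ge0.
apply: nearW => n; rewrite sumEFin lee_fin -(ler_pM2l q0) (le_trans (bound n))//.
by apply: le_trans Mc; rewrite gerBl powR_ge0.
Qed.

End power_series.

(** * Points whose digits are eventually large *)

Section upper_bound.
Context {R : realType} (d : R) (f : nat -> R -> R).
Hypothesis f_gauss : d_decaying_gauss_like d f.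
Hypothesis d_gt1 : 1 < d.

Definition tail_ge (M N : nat) : set R :=
  [set x | exists2 a, coding f x a & forall n, (N <= n)%N -> (M <= a n)%N].

Lemma tail_ge01 M N : tail_ge M N `<=` `[0, 1].
Proof. by move=> x [a xa _]; exact: (coding_mem01 f_gauss xa). Qed.

Lemma tail_ge0_sub M : tail_ge M.+1 0 `<=` \bigcup_i (f (i + M).+1 @` tail_ge M.+1 0).
Proof.
move=> x [a xa aM]; have [u [u01 -> ua]] := coding_step f_gauss xa.
exists (a 0%N - M.+1)%N => //; exists u.
  by exists (a \o S) => // n _; exact: aM.
by rewrite -addnS subnK// aM.
Qed.

Lemma tail_geS_sub M N : tail_ge M N.+1 `<=` \bigcup_i (f i.+1 @` tail_ge M N).
Proof.
move=> x [a xa aM]; have [u [u01 -> ua]] := coding_step f_gauss xa.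
exists (a 0%N).-1 => //; exists u; last by rewrite prednK//; exact: xa.1.
by exists (a \o S) => // n Nn; exact: aM.
Qed.

Lemma tail_ge_null (s : R) : 1 / d < s ->
  exists M, forall N, content_null s (tail_ge M N).
Proof.
move=> ds; have d0 : 0 < d by exact: lt_trans d_gt1.
have s0 : 0 < s by apply: lt_trans ds; rewrite divr_gt0.
have sd1 : 1 < s * d by rewrite -ltr_pdivrMr.
(* This choice gives [(d - eps) * s = (d * s + 1) / 2 > 1], so the [s]-th powers of the Lipschitz
   constants are summable. *)
pose eps := (d - s^-1) / 2.
have eps0 : 0 < eps.
  by rewrite divr_gt0// subr_gt0 -[ltLHS]mul1r ltr_pdivrMr// mulrC.
have p1 : 1 < (d - eps) * s.
  rewrite /eps; have : s^-1 * s = 1 by rewrite mulVf// gt_eqF.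
  set t := s^-1 => ts; nra.
have [C1 [C2 [_ C20 h]]] := gauss_bilipschitz f_gauss eps0.
(* The tail is chosen so that, after multiplication by [C2^s], the [s]-th powers of the Lipschitz
   constants sum to at most 1/2. *)
have [M hM] : exists M : nat, (\sum_(0 <= i <oo)
    ((i + M).+1%:R `^ (- ((d - eps) * s)) : R)%:E <= (C2 `^ s * 2)^-1%:E)%E.
  by apply: power_series_tail => //; rewrite invr_gt0 mulr_gt0 ?powR_gt0.
exists M.+1.
pose L i : R := C2 / (i + M).+1%:R `^ (d - eps).
have L0 i : 0 < L i by rewrite divr_gt0// powR_gt0 ltr0n.
have halve c : 0 <= c -> coverable s (tail_ge M.+1 0) c ->
    coverable s (tail_ge M.+1 0) (c / 2).
  move=> c0 Tc; apply: sub_coverable (@tail_ge0_sub M) _.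
  apply: (coverable_bigcup (c := fun i => L i `^ s * c)) => [i|].
    apply: coverable_image Tc => //; first exact: ltW.
      exact: tail_ge01.
    by move=> x y x01 y01; have /andP[] := h (i + M).+1 x y (ltn0Sn _) x01 y01.
  under eq_eseriesr => i _.
    rewrite /L powRM ?invr_ge0 ?powR_ge0 ?ltW// -powRN -powRrM mulNr.
    rewrite mulrAC EFinM. over.
  rewrite nneseriesZl; last by move=> *; rewrite lee_fin powR_ge0.
  apply: (@le_trans _ _ ((C2 `^ s * c)%:E * (C2 `^ s * 2)^-1%:E))%E.
    by apply: lee_wpmul2l => //; rewrite lee_fin mulr_ge0// powR_ge0.
  rewrite -EFinM lee_fin invfM mulrACA divff ?mul1r//.
  by rewrite gt_eqF// powR_gt0.
have iter n : coverable s (tail_ge M.+1 0) (2^-1 ^+ n).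
  elim: n => [|n IH]; first exact: sub_coverable (@tail_ge01 _ _) (coverable01 s0).
  by rewrite exprSr; apply: halve => //; rewrite exprn_ge0.
elim=> [c c0|N IH].
  have [n nc] := half_expr_lt c0.
  by apply: (@le_coverable _ _ _ (2^-1 ^+ n)) => //; exact: ltW.
(* An unrestricted first digit costs only a countable union of Lipschitz images, which preserves
   null content. *)
apply: content_null_sub (@tail_geS_sub _ _) _.
apply: content_null_bigcup => // i.
apply: (content_null_image s0 (L := C2 / i.+1%:R `^ (d - eps))) IH.
- by rewrite divr_gt0// powR_gt0 ltr0n.
- exact: tail_ge01.
- by move=> x y x01 y01; have /andP[] := h i.+1 x y (ltn0Sn _) x01 y01.
Qed.

End upper_bound.

(** * Digit scales with prescribed convergence exponent *)

Section convergence_exponent.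
Context {R : realType}.
Implicit Types (s alpha : R) (a k : nat -> nat).

Lemma nneseries_le (u : nat -> R) C : (forall n, 0 <= u n) ->
  (forall n, \sum_(0 <= i < n) u i <= C) -> (\sum_(0 <= i <oo) (u i)%:E <= C%:E)%E.
Proof.
move=> u0 uC; apply: lime_le; first by apply: is_cvg_nneseries => *; rewrite lee_fin.
by apply: nearW => n; rewrite sumEFin lee_fin.
Qed.

Lemma nneseries_ge_harmonic (u : nat -> R) c : 0 < c ->
  (forall n, c / n.+1%:R <= u n) -> (\sum_(0 <= i <oo) (u i)%:E = +oo)%E.
Proof.
move=> c0 cu; have u0 n : 0 <= u n by apply: le_trans (cu n); rewrite divr_ge0// ltW.
apply/eqP; rewrite -leye_eq leNgt; apply/negP => ltoo.
apply: (@dvg_harmonic R).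
apply: series_le_cvg (is_cvg_seriesZ (k := c^-1) (nnseries_is_cvg u0 ltoo)) => n.
- exact: harmonic_ge0.
- by rewrite mulr_ge0 ?invr_ge0 ?u0 ?ltW.
- by rewrite -[leLHS](mulKf (lt0r_neq0 c0)) ler_pM2l ?invr_gt0//; exact: cu.
Qed.

(** Since [(i + M).+1 <= M.+1 * i.+1], each term is at most [M.+1^p] times the corresponding term of
    a tail with finite sum. *)
Lemma power_series_lty (p : R) : 1 < p ->
  (\sum_(0 <= i <oo) (i.+1%:R `^ (- p))%:E < +oo)%E.
Proof.
move=> p1; have [M hM] := power_series_tail p1 (@ltr01 R).
apply: (@le_lt_trans _ _ ((M.+1%:R `^ p)%:E *
  (\sum_(0 <= i <oo) ((i + M).+1%:R `^ (- p))%:E)))%E; last first.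
  apply: (@le_lt_trans _ _ ((M.+1%:R `^ p)%:E * 1%:E)%E); last by rewrite -EFinM ltry.
  by apply: lee_wpmul2l => //; rewrite lee_fin powR_ge0.
rewrite -nneseriesZl; last by move=> *; rewrite lee_fin powR_ge0.
apply: lee_nneseries => [i _ _|i _]; first by rewrite lee_fin powR_ge0.
rewrite -EFinM lee_fin !powRN ler_pdivlMr ?powR_gt0 ?ltr0n//.
rewrite ler_pdivrMl ?powR_gt0 ?ltr0n// -powRM ?ler0n//.
apply: ge0_ler_powR; rewrite ?nnegrE ?mulr_ge0 ?ler0n//; first exact: ltW (lt_trans ltr01 p1).
by rewrite -natrM ler_nat; lia.
Qed.

(** Common shape of the convergence exponent and of the Hausdorff dimension; the critical value
    [alpha] itself may or may not belong to [S]. *)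
Lemma ereal_inf_threshold (S : set R) alpha : (forall s, alpha < s -> S s) ->
  (forall s, S s -> alpha <= s) -> ereal_inf [set s%:E | s in S] = alpha%:E.
Proof.
move=> gtS geS; apply/eqP; rewrite eq_le; apply/andP; split.
  apply/lee_addgt0Pr => e e0; rewrite -EFinD; apply: ereal_inf_lbound.
  by exists (alpha + e) => //; apply: gtS; rewrite ltrDl.
by apply: le_ereal_inf_tmp => _ [s Ss <-]; rewrite lee_fin geS.
Qed.

Lemma powRN_anti s (x y : R) : 0 <= s -> 0 < x -> x <= y -> y `^ (- s) <= x `^ (- s).
Proof.
move=> s0 x0 xy; have y0 := lt_le_trans x0 xy.
by rewrite !powRN lef_pV2 ?posrE ?powR_gt0// ge0_ler_powR ?nnegrE ?(ltW x0) ?(ltW y0).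
Qed.

Definition digit_exponent a : \bar R :=
  ereal_inf [set s%:E | s in [set s : R | 0 <= s /\
    (\sum_(0 <= n <oo) ((a n)%:R `^ (- s))%:E < +oo)%E]].

(** The conditions serve, in order, the mixed radix expansion, the comparison of [k n.+1] with
    [k n], and the absorption of constants in [growing_scale_bounded]. *)
Definition growing_scale k := [/\ forall n, (1 < k n)%N,
  exists B, forall n, (k n.+1 <= B * k n)%N &
  forall A : R, exists N, forall n, (N <= n)%N -> A <= (k n)%:R].

(** For every [s > 0] the series is dominated by a geometric one of ratio [2^-s]. The factor [M.+2]
    keeps the scale above both [M] and 1. *)
Lemma exponential_scale M : exists k, [/\ growing_scale k, forall n, (M <= k n)%N &
  forall a, (forall n, k n <= a n <= 4 * k n)%N -> digit_exponent a = 0%:E].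
Proof.
pose k n := (M.+2 * 2 ^ n)%N; exists k.
have kM n : (M.+2 <= k n)%N by rewrite leq_pmulr// expn_gt0.
have k2 n : (2 ^ n <= k n)%N by rewrite leq_pmull.
split=> [|n|a ka]; last 2 first.
- by apply: leq_trans (kM n); rewrite -addn2 leq_addr.
- apply: ereal_inf_threshold => [s s0|s []//]; split; first exact: ltW.
  pose q : R := 2 `^ (- s).
  have q0 : 0 <= q by rewrite powR_ge0.
  have q1 : q < 1.
    have h1 : 1 `^ s = 1 :> R by rewrite powR1.
    by rewrite /q powRN invf_lt1 ?powR_gt0// -[ltLHS]h1 gt0_ltr_powR ?nnegrE ?ltr1n.
  apply: (@le_lt_trans _ _ ((1 - q)^-1)%:E); last exact: ltry.
  apply: nneseries_le => n; first exact: powR_ge0.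
  apply: (@le_trans _ _ (\sum_(0 <= i < n) q ^+ i)).
    apply: ler_sum => i _.
    have /andP[ki _] := ka i.
    rewrite -powR_mulrn// -powRrM mulrC powRrM powR_mulrn//.
    apply: powRN_anti; first exact: ltW.
      by rewrite exprn_gt0.
    by rewrite -natrX ler_nat (leq_trans (k2 i)).
  rewrite -[leRHS]mul1r ler_pdivlMr ?subr_gt0//.
  rewrite (_ : _ * _ = 1 - q ^+ n); first by rewrite gerBl exprn_ge0.
  by elim: n => [|n IH]; rewrite ?big_nil ?big_nat_recr//= ?mulrDl ?IH ?exprS; ring.
- split=> [n||A].
  + by apply: leq_trans (kM n).
  + by exists 2%N => n; rewrite /k expnS mulnCA.
  + exists (Num.truncn A).+1 => n An; apply: le_trans (ltW (truncnS_gt A)) _.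
    by rewrite ler_nat (leq_trans An)// (leq_trans _ (k2 n))// ltnW// ltn_expl.
Qed.

(** Up to constant factors the digits are [n.+1^(1 / alpha)], so their [-s]-th powers behave like
    [n.+1^(- s / alpha)]: summable for [s > alpha], at least harmonic for [s < alpha]. *)
Lemma power_scale alpha M : 0 < alpha -> exists k,
  [/\ growing_scale k, forall n, (M <= k n)%N &
  forall a, (forall n, k n <= a n <= 4 * k n)%N -> digit_exponent a = alpha%:E].
Proof.
move=> al0.
pose g n : R := n.+1%:R `^ alpha^-1.
have g1 n : 1 <= g n.
  have h1 : 1 `^ alpha^-1 = 1 :> R by rewrite powR1.
  by rewrite -h1 ge0_ler_powR ?nnegrE ?invr_ge0 ?(ltW al0)// ler1n.
have g0 n : 0 < g n by exact: lt_le_trans (g1 n).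
pose k n := (M.+2 * (Num.truncn (g n)).+1)%N; exists k.
have kM n : (M.+2 <= k n)%N by rewrite leq_pmulr.
have kg n : g n <= (k n)%:R.
  apply: le_trans (ltW (truncnS_gt (g n))) _.
  by rewrite ler_nat leq_pmull.
have gk n : (k n)%:R <= M.+2%:R * 2 * g n.
  rewrite natrM -mulrA ler_pM2l ?ltr0n// mulr_natl mulr2n -natr1 lerD//.
  by rewrite truncn_le ltW.
have gs s n : g n `^ (- s) = n.+1%:R `^ (- (s / alpha)).
  by rewrite /g -powRrM; congr (_ `^ _); rewrite mulrN mulrC.
split=> [|n|a ka]; last 2 first.
- by apply: leq_trans (kM n); rewrite -addn2 leq_addr.
- apply: ereal_inf_threshold => [s als|s [s0]]; last first.
    rewrite ltNge => H; rewrite leNgt; apply: contra H => sal.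
    (* [D * g n] bounds the digits: 4 comes from the digit range, [M.+2 * 2] from rounding [g n] up
       in [k n]. *)
    pose D : R := 4 * (M.+2%:R * 2).
    have D0 : 0 < D by rewrite !mulr_gt0// ltr0n.
    rewrite (@nneseries_ge_harmonic _ (D `^ (- s)))// ?powR_gt0// => n.
    have /andP[ka1 ka2] := ka n.
    apply: (@le_trans _ _ ((D * g n) `^ (- s))); last first.
      apply: powRN_anti => //.
        by rewrite ltr0n (leq_trans _ ka1)// (leq_trans _ (kM n)).
      rewrite /D -mulrA; apply: (@le_trans _ _ (4 * k n)%:R); first by rewrite ler_nat.
      by rewrite natrM ler_pM2l.
    rewrite powRM ?(ltW D0) ?(ltW (g0 n))// ler_pM2l ?powR_gt0// gs powRN.
    rewrite lef_pV2 ?posrE ?powR_gt0 ?ltr0n//.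
    by apply: ler1_powR; rewrite ?ler1n// ler_pdivrMr// mul1r ltW.
  have s0 : 0 < s by exact: lt_trans als.
  split; first exact: ltW.
  apply: le_lt_trans (@power_series_lty (s / alpha) _); last by rewrite ltr_pdivlMr// mul1r.
  apply: lee_nneseries => [i _ _|i _]; rewrite lee_fin ?powR_ge0// -gs.
  apply: powRN_anti => //; first exact: ltW.
  by have /andP[ki _] := ka i; apply: le_trans (kg i) _; rewrite ler_nat.
- split=> [n||A].
  + by apply: leq_trans (kM n).
  + pose B : R := M.+2%:R * 2 * 2 `^ alpha^-1.
    exists (Num.truncn B).+1 => n; rewrite -(ler_nat R) natrM.
    apply: le_trans (gk _) _.
    apply: (@le_trans _ _ (B * g n)).
      rewrite /B -(mulrA _ _ (g n)) ler_pM2l ?mulr_gt0 ?ltr0n// /g -powRM ?ler0n//.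
      apply: ge0_ler_powR; rewrite ?nnegrE ?mulr_ge0 ?ler0n ?invr_ge0 ?(ltW al0)//.
      by rewrite -natrM ler_nat; lia.
    apply: ler_pM => //; first by rewrite !mulr_ge0 ?powR_ge0 ?ler0n.
      exact: ltW.
    by rewrite ltW// truncnS_gt.
  (* [A] may be negative; replacing it by its maximum with 0 allows it to be recovered as the
     [1 / alpha]-th power of its [alpha]-th power. *)
  + exists (Num.truncn (Num.max A 0 `^ alpha)).+1 => n An.
    apply: le_trans (kg n); apply: (@le_trans _ _ (Num.max A 0)); first by rewrite le_max lexx.
    have A0 : 0 <= Num.max A 0 by rewrite le_max lexx orbT.
    rewrite -[leLHS](powRr1 A0) -[X in _ `^ X <= _](divff (lt0r_neq0 al0)) powRrM.
    apply: ge0_ler_powR; rewrite ?nnegrE ?powR_ge0 ?ler0n ?invr_ge0 ?(ltW al0)//.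
    by rewrite ltW// (lt_le_trans (truncnS_gt _))// ler_nat ltnW.
Qed.

Lemma digit_scale alpha M : 0 <= alpha -> exists k,
  [/\ growing_scale k, forall n, (M <= k n)%N &
  forall a, (forall n, k n <= a n <= 4 * k n)%N -> digit_exponent a = alpha%:E].
Proof.
rewrite le_eqVlt => /predU1P[<-|]; last exact: power_scale.
exact: exponential_scale.
Qed.

End convergence_exponent.

(** * The lower bound *)

Section mixed_radix.
Context {R : realType} (k : nat -> nat).
Hypothesis k_gt1 : forall n, (1 < k n)%N.
Implicit Types (t : R) (n : nat).

Definition radix_prod n : nat := \prod_(i < n) k i.
(** For [t] in [0, 1), the first [n] radix digits packed into one integer; digit [n] is therefore
    the last one of the packed integer of length [n.+1]. *)
Definition radix_approx t n : nat := Num.truncn ((radix_prod n)%:R * t).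
Definition radix_digit t n : nat := radix_approx t n.+1 %% k n.

Let k_gt0 n : (0 < k n)%N. Proof. exact: ltnW. Qed.

Lemma radix_prod_gt0 n : (0 < radix_prod n)%N.
Proof. by rewrite /radix_prod prodn_gt0. Qed.

Lemma radix_prodS n : radix_prod n.+1 = (radix_prod n * k n)%N.
Proof. by rewrite /radix_prod big_ord_recr. Qed.

Lemma exp2_le_radix_prod n : (2 ^ n <= radix_prod n)%N.
Proof.
by elim: n => [|n IH]; rewrite ?radix_prodS ?expnSr ?leq_mul// /radix_prod big_ord0.
Qed.

(** By Euclidean division it amounts to [floor (floor (k * y) / k) = floor y] for a positive integer
    [k]. *)
Lemma radix_approxS t n : 0 <= t ->
  radix_approx t n.+1 = (radix_approx t n * k n + radix_digit t n)%N.
Proof.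
move=> t0; rewrite /radix_digit {1}(divn_eq (radix_approx t n.+1) (k n)).
congr (_ * _ + _)%N.
have /andP[l u] := @truncn_itv R ((radix_prod n)%:R * t) (mulr_ge0 (ler0n _ _) t0).
have /andP[l' u'] := @truncn_itv R ((radix_prod n.+1)%:R * t) (mulr_ge0 (ler0n _ _) t0).
rewrite -/(radix_approx t n) in l u; rewrite -/(radix_approx t n.+1) in l' u'.
have e : (radix_prod n.+1)%:R * t = (k n)%:R * ((radix_prod n)%:R * t).
  by rewrite radix_prodS natrM mulrAC mulrC.
have kn0 : 0 < (k n)%:R :> R by rewrite ltr0n.
apply/eqP; rewrite eqn_leq leq_divRL// -ltnS ltn_divLR//; apply/andP; split.
  rewrite -(ltr_nat R) natrM (le_lt_trans l')// e mulrC ltr_pM2r//.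
rewrite /radix_approx truncn_ge_nat ?mulr_ge0 ?ler0n// e natrM mulrC.
by rewrite ler_pM2l.
Qed.

(** Equal digits give equal packed integers, so both points lie in one interval of length
    [1 / radix_prod n]. *)
Lemma radix_close t t' n : 0 <= t < 1 -> 0 <= t' < 1 ->
  (forall m, (m < n)%N -> radix_digit t m = radix_digit t' m) ->
  `|t - t'| <= (radix_prod n)%:R^-1.
Proof.
move=> /andP[t0 t1] /andP[t'0 t'1] tt'.
have : radix_approx t n = radix_approx t' n.
  elim: n tt' => [|n IH] tt'.
    have h u : 0 <= u < 1 -> radix_approx u 0 = 0%N.
      move=> u01; rewrite /radix_approx /radix_prod big_ord0 mul1r.
      by apply: truncn_def.
    by rewrite !h ?t0 ?t'0.
  rewrite !radix_approxS// IH ?tt'// => m mn.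
  by rewrite tt'// ltnS ltnW.
have /andP[l u] := @truncn_itv R ((radix_prod n)%:R * t) (mulr_ge0 (ler0n _ _) t0).
have /andP[l' u'] := @truncn_itv R ((radix_prod n)%:R * t') (mulr_ge0 (ler0n _ _) t'0).
rewrite /radix_approx => e; rewrite e in l u.
have K0 : 0 < (radix_prod n)%:R :> R by rewrite ltr0n radix_prod_gt0.
rewrite -[leRHS]mul1r ler_pdivlMr// -(gtr0_norm K0) -normrM ler_norml.
move: l u l' u'; rewrite -natr1; set N := _%:R; set K := _%:R => *.
by apply/andP; split; lra.
Qed.

Lemma radix_digit_diff t t' : 0 <= t < 1 -> 0 <= t' < 1 -> t != t' ->
  exists n, radix_digit t n != radix_digit t' n /\
    forall m, (m < n)%N -> radix_digit t m = radix_digit t' m.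
Proof.
move=> t01 t'01 tt'.
have [|n tn min] := ex_minnP (P := fun n => radix_digit t n != radix_digit t' n).
  apply: contrapT => /forallNP h; move/negP: tt'; apply; rewrite -subr_eq0 -normr_eq0.
  rewrite eq_le normr_ge0 andbT; apply/ler_addgt0Pr => e e0; rewrite add0r.
  pose n := (Num.truncn e^-1).+1.
  apply: le_trans (@radix_close t t' n t01 t'01 _) _.
    by move=> m _; apply/eqP; apply/negPn/negP/h.
  rewrite -[leRHS]invrK lef_pV2 ?posrE ?invr_gt0 ?ltr0n ?radix_prod_gt0//.
  apply: le_trans (ltW (truncnS_gt _)) _.
  by rewrite ler_nat (leq_trans _ (exp2_le_radix_prod _))// ltnW// ltn_expl.
exists n; split=> // m mn; apply/eqP; rewrite -[_ == _]negbK; apply/negP => /min.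
by rewrite leqNgt mn.
Qed.

End mixed_radix.

(** * Lebesgue measure bound for covers of [0, 1) *)

Section lebesgue_cover.
Context {R : realType}.

(** A nonempty [A n] with finite [r n] lies in the interval of radius [r n] around any of its
    points, whence the factor 2; subadditivity is applied to these measurable enlargements. *)
Lemma unit_interval_cover (A : nat -> set R) (r : nat -> \bar R) :
  `[0, 1[ `<=` \bigcup_n A n -> (forall n, 0 <= r n)%E ->
  (forall n t t', A n t -> A n t' -> (`|t - t'|%:E <= r n)%E) ->
  (1 <= 2%:E * \sum_(0 <= n <oo) r n)%E.
Proof.
move=> cov r0 Ar.
have /choice[W hW] : forall n, exists W : set R,
    [/\ measurable W, A n `<=` W & (lebesgue_measure W <= 2%:E * r n)%E].
  move=> n; have [->|/set0P[t At]] := eqVneq (A n) set0.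
    by exists set0; split=> //; rewrite measure0 mule_ge0// lee_fin.
  have := r0 n; case rn : (r n) => [x| |]// x0.
  - exists `[t - x, t + x]%classic; split=> //.
      move=> t' At'; have := Ar n _ _ At' At.
      rewrite rn lee_fin ler_norml /= in_itv/= => /andP[? ?].
      by apply/andP; split; lra.
    rewrite lebesgue_measure_itv/=; case: ifP => _; last by rewrite mule_ge0// lee_fin.
    by rewrite -EFinB -EFinM lee_fin; lra.
  - exists setT; split=> //; rewrite gt0_muley ?leey// lte_fin//.
rewrite -nneseriesZl//.
have -> : 1%E = lebesgue_measure `[0 : R, 1[%classic.
  by rewrite lebesgue_measure_itv/= lte_fin ltr01 sube0.
apply: (@le_trans _ _ (\sum_(0 <= n <oo) lebesgue_measure (W n)))%E.
  apply: measure_sigma_subadditive => //; first by move=> n; have [] := hW n.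
  move=> t /cov[n _ At]; exists n => //; have [_ + _] := hW n; exact.
by apply: lee_nneseries => // n _; have [] := hW n.
Qed.

End lebesgue_cover.

Lemma eventually_nonincreasing_bounded (R : realType) (u : nat -> R) N :
  (forall n, (N <= n)%N -> u n.+1 <= u n) -> exists2 C, 0 < C & forall n, u n <= C.
Proof.
move=> uN; pose C := 1 + \sum_(i < N.+1) `|u i|.
have small n : (n <= N)%N -> u n <= C.
  move=> nN; rewrite /C (bigD1 (Ordinal (nN : (n < N.+1)%N)))//= addrCA.
  by rewrite ler_wpDr ?addr_ge0 ?sumr_ge0// ler_norm.
exists C; first by rewrite ltr_pwDl// sumr_ge0.
move=> n; have [/small//|Nn] := leqP n N.
rewrite -(subnKC (ltnW Nn)); elim: (n - N)%N => [|m IH]; first by rewrite addn0 small.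
by rewrite addnS (le_trans _ IH)// uN// leq_addr.
Qed.

Lemma powR_prod (R : realType) (I : Type) (r : seq I) (F : I -> R) s : (forall i, 0 <= F i) ->
  (\prod_(i <- r) F i) `^ s = \prod_(i <- r) F i `^ s.
Proof.
move=> F0; elim: r => [|i r IH]; first by rewrite !big_nil powR1.
by rewrite !big_cons powRM ?IH// prodr_ge0.
Qed.

(** * Even digit sequences and growth of the scale *)

Section even_digits.
Context {R : realType}.

(* Distinct even digits leave a whole cylinder between them, whence the
   separation of the coded points. *)
Definition even_digits (k : nat -> nat) (t : R) n : nat := 2 * (k n + radix_digit k t n).

Lemma even_digits_bound k t n : (1 < k n)%N ->
  (k n <= even_digits k t n <= 4 * k n)%N.
Proof.
move=> k1; have : (radix_digit k t n < k n)%N by rewrite ltn_mod ltnW.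
by rewrite /even_digits; lia.
Qed.

(* Growth of the scale makes [(k n)^(1 - th)] beat any constant, so the partial
   products below eventually decrease. *)
Lemma growing_scale_bounded k (c th : R) : growing_scale (R := R) k -> 0 < c ->
  0 <= th < 1 -> exists2 C, 0 < C &
  forall n, (radix_prod k n)%:R^-1 <= C * \prod_(m < n.+1) (c / (k m)%:R `^ th).
Proof.
move=> [k1 [B kB] kinf] c0 /andP[th0 th1].
have k0 n : 0 < (k n)%:R :> R by rewrite ltr0n ltnW.
have K0 n : 0 < (radix_prod k n)%:R :> R by rewrite ltr0n radix_prod_gt0.
have B0 : 0 < B%:R :> R.
  rewrite ltr0n lt0n; apply: contraTneq (kB 0%N) => ->.
  by rewrite mul0n -ltnNge ltnW.
pose P n : R := \prod_(m < n.+1) (c / (k m)%:R `^ th).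
have P0 n : 0 < P n by apply: prodr_gt0 => m _; rewrite divr_gt0// powR_gt0.
pose u n := (radix_prod k n)%:R^-1 / P n.
pose G := B%:R `^ th / c.
have G0 : 0 < G by rewrite divr_gt0// powR_gt0.
(* The product in [P n] has one factor more than [radix_prod k n], so [u n.+1 / u n] is
   [(k n.+1)^th / (c * k n)]. This is at most [G * (k n)^(th - 1)], hence at most 1 from [N] on. *)
have [N hN] := kinf (G `^ (1 - th)^-1).
have [n Nn|C C0 uC] := @eventually_nonincreasing_bounded R u N.
  have th1' : 0 < 1 - th by rewrite subr_gt0.
  have kG : G <= (k n)%:R `^ (1 - th).
    rewrite -[leLHS](powRr1 (ltW G0)) -[X in _ `^ X <= _](mulVf (lt0r_neq0 th1')) powRrM.
    by apply: ge0_ler_powR; rewrite ?nnegrE ?powR_ge0 ?ler0n ?(ltW th1')// hN.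
  rewrite /u /P big_ord_recr/= -/(P n) radix_prodS natrM !invfM invrK.
  rewrite [leLHS](_ : _ = (radix_prod k n)%:R^-1 / P n *
    ((k n)%:R^-1 * (k n.+1)%:R `^ th / c)); last first.
    by field; rewrite !gt_eqF.
  rewrite ler_piMr ?mulr_ge0 ?invr_ge0 ?(ltW (P0 n)) ?(ltW (K0 n))//.
  rewrite -mulrA ler_pdivrMl// mulr1 ler_pdivrMr//.
  apply: (@le_trans _ _ (B%:R `^ th * (k n)%:R `^ th)).
    rewrite -powRM ?ler0n// -natrM; apply: ge0_ler_powR; rewrite ?nnegrE ?ler0n//.
    by rewrite ler_nat.
  have -> : B%:R `^ th = G * c by rewrite divfK// gt_eqF.
  rewrite mulrAC ler_pM2r//; apply: (@le_trans _ _ ((k n)%:R `^ (1 - th) * (k n)%:R `^ th)).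
    by rewrite ler_pM2r// powR_gt0.
  by rewrite -powRD ?subrK ?powRr1 ?ler0n// oner_eq0.
by exists C => // n; have := uC n; rewrite /u ler_pdivrMr.
Qed.

End even_digits.

(** * Hölder inverse of the coding and positivity of the measure *)

Section lower_bound.
Context {R : realType} (d : R) (f : nat -> R -> R).
Hypothesis d_gt1 : 1 < d.
Hypothesis f_gauss : d_decaying_gauss_like d f.

(** At the first differing radix digit [n], the distance of [t] and [t'] is at most
    [1 / radix_prod k n], which [growing_scale_bounded] compares with the [s]-th power of the
    separation of the coded points. *)
Lemma coding_inverse_holder (k : nat -> nat) (s : R) :
  growing_scale (R := R) k -> 0 <= s -> s < 1 / d ->
  exists2 C, 0 < C & forall t t' x y : R, 0 <= t < 1 -> 0 <= t' < 1 ->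
    coding f x (even_digits k t) -> coding f y (even_digits k t') ->
    `|t - t'| <= C * `|x - y| `^ s.
Proof.
move=> kg s0 sd; have [k1 _ _] := kg.
have d0 : 0 < d by exact: lt_trans d_gt1.
have sd1 : s * d < 1 by rewrite -ltr_pdivlMr.
(* Chosen so that [(d + eps) * s = 1 - eps < 1]; the denominator [s + 1] is positive also for
   [s = 0]. *)
pose eps := (1 - s * d) / (s + 1).
have s1 : 0 < s + 1 by rewrite ltr_wpDl.
have eps0 : 0 < eps by rewrite divr_gt0// subr_gt0.
have th1 : (d + eps) * s < 1.
  have : eps * (s + 1) = 1 - s * d by rewrite divfK// gt_eqF.
  by move: eps eps0 => e; nra.
have [c c0 sep] := coding_separation d_gt1 f_gauss eps0.
have [|C C0 hC] := growing_scale_bounded kg (powR_gt0 s c0) (th := (d + eps) * s).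
  by rewrite th1 mulr_ge0 ?addr_ge0 ?(ltW d0) ?(ltW eps0).
exists C => // t t' x y t01 t'01 xt yt'.
have [->|tt'] := eqVneq t t'; first by rewrite subrr normr0 mulr_ge0 ?powR_ge0 ?ltW.
have [n [tn tm]] := radix_digit_diff k1 t01 t'01 tt'.
apply: le_trans (radix_close k1 t01 t'01 tm) (le_trans (hC n) _).
rewrite ler_pM2l//.
have ev (u : R) m : ~~ odd (even_digits k u m) by rewrite /even_digits mul2n odd_double.
have bd (u : R) m : (even_digits k u m <= 4 * k m)%N by have /andP[] := even_digits_bound u (k1 m).
have k0 m : (0 < k m)%N by exact: ltnW.
have h := sep k n _ _ x y k0 xt yt' (bd t) (bd t') (ev t) (ev t') _ _.
have P0 m : 0 <= c / (k m)%:R `^ (d + eps) by rewrite divr_ge0 ?powR_ge0 ?ltW.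
under eq_bigr => m _.
  have -> : c `^ s / (k m)%:R `^ ((d + eps) * s) = (c / (k m)%:R `^ (d + eps)) `^ s.
    by rewrite powRM ?invr_ge0 ?powR_ge0 ?(ltW c0)// -!powRN -!powRrM mulNr.
  over.
rewrite -powR_prod//.
apply: ge0_ler_powR; rewrite ?nnegrE ?prodr_ge0//; apply: h.
  by move=> m mn; rewrite /even_digits tm.
by rewrite /even_digits eqn_pmul2l// eqn_add2l.
Qed.

(** All these digits exceed 1, so the code is unique and [digits f x] is the constructed
    sequence. *)
Lemma tau1_level_set_mem alpha k (t x : R) : growing_scale (R := R) k ->
  (forall a, (forall n, k n <= a n <= 4 * k n)%N -> digit_exponent a = alpha%:E) ->
  coding f x (even_digits k t) -> tau1_level_set f alpha x.
Proof.
move=> [k1 _ _] ka xt; set a := even_digits k t in xt.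
have ab n : (k n <= a n <= 4 * k n)%N by exact: even_digits_bound.
have a1 n : (1 < a n)%N by have /andP[+ _] := ab n; exact: leq_trans.
have uniq b : coding f x b -> b = a by move=> xb; exact/esym/(coding_unique f_gauss a1 xt xb).
have dx : digits f x = a by exact: xget_unique.
split.
- by rewrite in_itv/= (gauss_coding_pos f_gauss xt) (gauss_coding_lt1 f_gauss xt).
- by exists a; split => // b /uniq.
- by rewrite /tau1 dx; exact: ka.
Qed.

Lemma hausdorff_measure_neq0 alpha s : 0 <= alpha -> 0 <= s -> s < 1 / d ->
  hausdorff_measure s (tau1_level_set f alpha) <> 0%E.
Proof.
move=> al0 s0 sd H0.
have [M codM] := coding_exists d_gt1 f_gauss.
have [k [kg kM ka]] := digit_scale M al0; have [k1 _ _] := kg.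
have [C C0 hC] := coding_inverse_holder kg s0 sd.
have /choice[g hg] : forall t : R, exists x, coding f x (even_digits k t).
  move=> t; apply: codM => n; have /andP[+ _] := even_digits_bound t (k1 n).
  exact: leq_trans.
(* A cover of total gauge below [1 / (4 * C)] pulls back to one of [0, 1) whose total is below
   [1 / 4]; the factor 2 of [unit_interval_cover] leaves at most [1 / 2 < 1]. *)
have : (hausdorff_premeasure s 1 (tau1_level_set f alpha) < (4 * C)^-1%:E)%E.
  apply: (@le_lt_trans _ _ 0%E); last by rewrite lte_fin invr_gt0 mulr_gt0.
  by rewrite -H0; apply: ereal_sup_ubound; exists 1 => //=; exact: ltr01.
move=> /ereal_inf_lt[_ [U [EU _] <-]] Ulow.
pose A n := [set t : R | 0 <= t < 1 /\ U n (g t)].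
have := @unit_interval_cover R A (fun n => C%:E * hausdorff_gauge s (U n))%E.
rewrite nneseriesZl; last by move=> *; exact: hausdorff_gauge_ge0.
move=> /(_ _ _ _)/wrap[|||].
- move=> t /=; rewrite in_itv/= => t01.
  by have [n _ Un] := EU _ (tau1_level_set_mem kg ka (hg t)); exists n.
- by move=> n; rewrite mule_ge0 ?hausdorff_gauge_ge0// lee_fin ltW.
- move=> n t t' [t01 Ut] [t'01 Ut'].
  apply: (@le_trans _ _ (C%:E * (`|g t - g t'| `^ s)%:E))%E.
    by rewrite -EFinM lee_fin; exact: hC.
  apply: lee_wpmul2l; first by rewrite lee_fin ltW.
  rewrite /hausdorff_gauge; case: pselect => /= [U0|_]; first by rewrite U0 in Ut.
  by rewrite -poweR_EFin; apply: poweR_le; rewrite ?lee_fin//; exact: le_diam.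
rewrite leNgt => /negP; apply.
apply: (@le_lt_trans _ _ (2%:E * (C%:E * (4 * C)^-1%:E)))%E.
  by rewrite !lee_pmul2l// ?lte_fin// ltW.
rewrite -!EFinM lte_fin (_ : _ * _ = 2^-1); last by field; rewrite gt_eqF.
by rewrite invf_lt1// ltr1n.
Qed.

End lower_bound.

(** * Level sets lie among the points with eventually large digits *)

Section upper_bound_level_set.
Context {R : realType} (d : R) (f : nat -> R -> R).

(** A finite [tau1] is not the infimum of the empty set, so some series of digit powers converges.
    Its terms eventually fall below [M.+1^-s], which forces the digits to be at least [M]. *)
Lemma tau1_level_set_sub alpha M :
  tau1_level_set f alpha `<=` \bigcup_N tail_ge f M N.
Proof.
move=> x [x01 [a [xa _]] tx].
have xd : coding f x (digits f x) by exact: xgetPex (ex_intro _ a xa).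
have [s [s0 sumlt]] : exists s : R, 0 <= s /\
    (\sum_(0 <= n <oo) ((digits f x n)%:R `^ (- s))%:E < +oo)%E.
  apply: contrapT => /forallNP h; move: tx; rewrite /tau1.
  rewrite (_ : [set s%:E | s in _] = set0) ?ereal_inf0//.
  by apply/seteqP; split=> [t [s hs _]|//]; exact: (h s hs).
have a0 n : 0 <= (digits f x n)%:R `^ (- s) by exact: powR_ge0.
have := nnseries_is_cvg a0 sumlt => /cvg_series_cvg_0/cvgrPdist_lt.
have M0 : 0 < M.+1%:R `^ (- s) :> R by rewrite powR_gt0 ?ltr0n.
move=> /(_ _ M0)[N _ hN]; exists N => //; exists (digits f x) => // n /hN /=.
rewrite sub0r normrN ger0_norm//; apply: contraTT; rewrite -ltnNge -leNgt => nM.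
apply: powRN_anti => //; first by rewrite ltr0n; exact: xd.1.
by rewrite ler_nat ltnW// ltnW.
Qed.

End upper_bound_level_set.

Theorem theorem1p6 (R : realType) (d : R) (d_gt1 : 1 < d)
    (f : nat -> R -> R) (f_gauss : d_decaying_gauss_like d f)
    (alpha : R) (alpha_ge0 : 0 <= alpha) :
  hausdorff_dim (tau1_level_set f alpha) = (1 / d)%:E.
Proof.
(* The two goals are null measure for every [s > 1 / d] and nonzero measure for every nonnegative
   [s < 1 / d]. *)
apply: ereal_inf_threshold => [s ds|s [s0 H0]].
  have s0 : 0 < s by apply: lt_trans ds; rewrite divr_gt0// (lt_trans ltr01).
  split; first exact: ltW.
  have [M hM] := tail_ge_null f_gauss d_gt1 ds.
  apply: content_null_measure => //.
  apply: content_null_sub (@tau1_level_set_sub _ f alpha M) _.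
  exact: content_null_bigcup.
rewrite leNgt; apply/negP => sd.
exact: (hausdorff_measure_neq0 d_gt1 f_gauss alpha_ge0 s0 sd H0).
Qed.
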